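(* If $f:\{0,1\}^n\to\{0,1\}$ is a read-once Boolean function, then $Q_E(f)=n$ if and only if $f$ is isomorphic to $\mathrm{AND}_n$.
   Context: A Boolean function is read-once if it can be represented by a Boolean formula over $\{\wedge,\vee,\neg\}$ (a binary tree whose internal nodes are labeled $\wedge$ or $\vee$ and whose leaves are literals $x_i$ or $\neg x_i$) in which each of the $n$ variables appears exactly once. $\mathrm{AND}_n(x)=1$ iff all bits are $1$. Two Boolean functions are isomorphic if one can be obtained from the other by permuting the input variables, negating some input variables, and possibly negating the output. $Q_E(f)$ is the exact quantum query complexity: the minimum number $t$ of queries in a quantum algorithm of the form $U_{t+1}QU_t\cdots QU_1$ applied to a fixed initial state in a Hilbert space with fixed orthonormal basis (the $U_j$ input-independent unitaries; $Q$ multiplies each basis state associated with index $i\in[n]$ by $(-1)^{x_i}$ and fixes basis states associated with no index), followed by a measurement in that basis, whose output equals $f(x)$ with probability $1$ for every input $x$. *)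

(* Defs.v *)
From mathcomp Require Import all_boot all_order all_fingroup all_algebra.
From mathcomp Require Import spectral.
From mathcomp Require Import complex.
From mathcomp Require Import reals.

Set Implicit Arguments.
Unset Strict Implicit.
Unset Printing Implicit Defensive.

Import Order.TTheory GRing.Theory Num.Theory.
Local Open Scope ring_scope.

Definition input (n : nat) : Type := {ffun 'I_n -> bool}.

Definition boolfun (n : nat) : Type := input n -> bool.

(* [Lit true i] is the literal x_i and [Lit false i] is its negation. *)
Inductive formula (n : nat) : Type :=
| Lit of bool & 'I_n
| And of formula n & formula n
| Or of formula n & formula n.

Fixpoint eval_formula (n : nat) (phi : formula n) (x : input n) : bool :=
  match phi with
  | Lit s i => if s then x i else ~~ x i
  | And phi1 phi2 => eval_formula phi1 x && eval_formula phi2 x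
  | Or phi1 phi2 => eval_formula phi1 x || eval_formula phi2 x
  end.

Fixpoint leaf_variables (n : nat) (phi : formula n) : seq 'I_n :=
  match phi with
  | Lit _ i => [:: i]
  | And phi1 phi2 => leaf_variables phi1 ++ leaf_variables phi2
  | Or phi1 phi2 => leaf_variables phi1 ++ leaf_variables phi2
  end.

(* Formulas have at least one leaf, so this is false when n = 0. *)
Definition read_once (n : nat) (f : boolfun n) : Prop :=
  exists phi : formula n,
    (forall i : 'I_n, count_mem i (leaf_variables phi) = 1%N) /\
    (forall x : input n, f x = eval_formula phi x).

Definition ANDn (n : nat) : boolfun n := fun x => [forall i, x i].

Definition isomorphic_boolfun (n : nat) (f g : boolfun n) : Prop :=
  exists (s : {perm 'I_n}) (a : {ffun 'I_n -> bool}) (c : bool),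
    forall x : input n, f x = c (+) g [ffun i => a i (+) x (s i)].

(* A [t]-query algorithm on n-bit inputs.  The state space is C^dim with its
   standard basis; [qa_label b] is the index in [n] associated with the basis
   state b, or None.  [qa_unitary j] is the unitary U_{j+1}; only the values at
   j <= t are used.  [qa_output b] is the answer given when the final
   measurement yields b. *)
Record query_algorithm (R : realType) (n t : nat) := QueryAlgorithm {
  qa_dim : nat;
  qa_label : 'I_qa_dim -> option 'I_n;
  qa_init : 'cV[R[i]]_qa_dim;
  qa_unitary : nat -> 'M[R[i]]_qa_dim;
  qa_output : 'I_qa_dim -> bool;
  qa_init_unit : \sum_b `|qa_init b 0| ^+ 2 = 1;
  qa_unitaryP : forall j : nat, (j <= t)%N -> qa_unitary j \is unitarymx
}.

Arguments qa_label {R n t} _ _.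
Arguments qa_output {R n t} _ _.

Definition query_mx (R : realType) (n d : nat) (label : 'I_d -> option 'I_n)
    (x : input n) : 'M[R[i]]_d :=
  diag_mx (\row_b (if label b is Some i then (-1) ^+ x i else 1)).

(* The state U_{k+1} Q U_k ... Q U_1 |init>, after k queries. *)
Fixpoint qa_state (R : realType) (n t : nat) (A : query_algorithm R n t)
    (x : input n) (k : nat) : 'cV[R[i]]_(qa_dim A) :=
  match k with
  | 0 => qa_unitary A 0 *m qa_init A
  | k'.+1 =>
      qa_unitary A k'.+1 *m (query_mx R (qa_label A) x *m qa_state A x k')
  end.

Definition output_probability (R : realType) (n t : nat)
    (A : query_algorithm R n t) (x : input n) (v : bool) : R[i] :=
  \sum_(b | qa_output A b == v) `|qa_state A x t b 0| ^+ 2.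

Definition computes_exactly (R : realType) (n t : nat)
    (A : query_algorithm R n t) (f : boolfun n) : Prop :=
  forall x : input n, output_probability A x (f x) = 1.

Definition exactly_computable (R : realType) (n : nat) (f : boolfun n)
    (t : nat) : Prop :=
  exists A : query_algorithm R n t, computes_exactly A f.

(* The equation Q_E(f) = q, as a relation: q is the least number of queries. *)
Definition is_QE (R : realType) (n : nat) (f : boolfun n) (q : nat) : Prop :=
  exactly_computable R f q /\
  (forall t : nat, exactly_computable R f t -> (q <= t)%N).

(* Main.v *)
(** A state of a query algorithm is a family of vectors indexed by the inputs,
    and equality of Gram matrices is all that is needed for a unitary to carry
    one family to another; so upper bounds amount to sequences of families
    whose Gram matrices match.  In this form algorithms can be composed
    adaptively, since scaling a family by the indicator of an outcome keeps the
    Gram equations.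

    A formula with m leaves takes at most m queries.  If it mixes the two
    connectives it contains, up to duality, some (A1 \/ A2) /\ B: reading
    subformulas one at a time reduces this to (l1 \/ l2) /\ l3 for literals,
    which has an exact two-query algorithm, and so one query is saved.
    Otherwise the formula is a conjunction or a disjunction of literals.

    Conversely, after t queries the amplitudes are multilinear polynomials of
    degree at most t in the signs (-1)^(x_i).  For a function isomorphic to
    AND, those of one answer vanish at all inputs but one, hence have full
    degree n unless they are all zero. *)

Require Import Defs.
From mathcomp Require Import all_boot reals.
From mathcomp Require Import all_order all_fingroup all_algebra spectral complex.
From mathcomp Require Import boolp ring lra zify.

Set Implicit Arguments.
Unset Strict Implicit.
Unset Printing Implicit Defensive.

Import Order.TTheory GRing.Theory Num.Theory.
Local Open Scope ring_scope.

(** * Families of states up to equality of Gram matrices *)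

Section StateLists.
Variables (R : realType) (n : nat).
Local Notation X := (input n).

(* One coordinate of the state in the standard basis: its label, and its
   amplitude as a function of the input. *)
Definition labelled : Type := option 'I_n * (X -> R).

Implicit Types (L : seq labelled) (v : labelled) (f g h : boolfun n).
Implicit Types (u : X -> R).

Definition gram L (x y : X) : R := \sum_(v <- L) v.2 x * v.2 y.

Definition phase (l : option 'I_n) (x : X) : R :=
  if l is Some i then (-1) ^+ x i else 1.

Definition query v : labelled := (v.1, fun x => phase v.1 x * v.2 x).

Definition scale u v : labelled := (v.1, fun x => u x * v.2 x).

Definition indicator (S : pred X) (x : X) : R := (S x)%:R.

(* Passing from L to L' stands for an input-independent unitary; at the end,
   orthogonality of the states with different answers lets a measurement tell
   them apart with certainty. *)
Fixpoint solves f (t : nat) L : Prop :=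
  if t is t'.+1 then
    exists2 L', gram L' =2 gram L & solves f t' (map query L')
  else forall x y, f x != f y -> gram L x y = 0.

Definition computable f t := solves f t [:: (None, fun=> 1)].

Lemma gram_cat L1 L2 x y : gram (L1 ++ L2) x y = gram L1 x y + gram L2 x y.
Proof. by rewrite /gram big_cat. Qed.

Lemma gram_scale u L x y : gram (map (scale u) L) x y = u x * u y * gram L x y.
Proof. by rewrite /gram big_map mulr_sumr; apply: eq_bigr => v _ /=; ring. Qed.

Lemma solves_eq f t L L' : gram L =2 gram L' -> solves f t L -> solves f t L'.
Proof.
case: t => [|t] eqL /=; first by move=> fL x y /fL; rewrite eqL.
by case=> L1 eqL1 fL1; exists L1 => // x y; rewrite eqL1.
Qed.

(** A surplus query is made idle by relabelling every coordinate [None], which keeps the Gram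
    matrix. *)
Lemma solves_mono f t s L : (t <= s)%N -> solves f t L -> solves f s L.
Proof.
elim: t s L => [|t IHt] [|s] L //=; last first.
  by move=> ts [L' eqL fL]; exists L' => //; apply: IHt.
elim: s L => [|s IHs] L _ fL.
  exists [seq (None, v.2) | v <- L] => [x y|x y /fL <-].
    by rewrite /gram big_map.
  by rewrite /gram !big_map; apply: eq_bigr => v _ /=; rewrite !mul1r.
exists [seq (None, v.2) | v <- L] => [x y|]; first by rewrite /gram big_map.
apply: IHs => // x y /fL <-.
by rewrite /gram !big_map; apply: eq_bigr => v _ /=; rewrite !mul1r.
Qed.

Lemma solves_nil f t : solves f t [::].
Proof. by apply: (@solves_mono _ 0) => // x y _; rewrite /gram big_nil. Qed.

Lemma solves_cat f t L1 L2 :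
  solves f t L1 -> solves f t L2 -> solves f t (L1 ++ L2).
Proof.
elim: t L1 L2 => [|t IHt] L1 L2 /=.
  by move=> f1 f2 x y fxy; rewrite gram_cat f1 ?f2 ?addr0.
case=> L1' eq1 f1 [L2' eq2 f2]; exists (L1' ++ L2').
  by move=> x y; rewrite !gram_cat eq1 eq2.
by rewrite map_cat; apply: IHt.
Qed.

Lemma query_scale u v : query (scale u v) = scale u (query v).
Proof. by congr pair; apply: funext => x /=; ring. Qed.

(** Scaling by [u] multiplies Gram entries by [u x * u y] and commutes with [query], so the lists
    that work for [h], once scaled, work for [f]. *)
Lemma solves_scale f h t L u :
    (forall x y, u x != 0 -> u y != 0 -> f x != f y -> h x != h y) ->
  solves h t L -> solves f t (map (scale u) L).
Proof.
move=> fh; elim: t L => [|t IHt] L /=.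
  move=> hL x y fxy; rewrite gram_scale.
  have [->|ux] := eqVneq (u x) 0; first by rewrite !mul0r.
  have [->|uy] := eqVneq (u y) 0; first by rewrite mulr0 mul0r.
  by rewrite hL ?mulr0 //; apply: fh.
case=> L' eqL hL; exists (map (scale u) L').
  by move=> x y; rewrite !gram_scale eqL.
rewrite -map_comp (eq_map (_ : _ =1 scale u \o query)).
  by rewrite map_comp; apply: IHt.
by move=> v /=; apply: query_scale.
Qed.

Lemma computable_on f h t (S : pred X) :
    (forall x, S x -> f x = h x) ->
  computable h t -> solves f t [:: (None, indicator S)].
Proof.
move=> fh /(@solves_scale f _ _ _ (indicator S)) fS.
apply: solves_eq (fS _) => [x y|x y].
  by rewrite /gram /= !big_seq1 /= !mulr1.
rewrite /indicator; case Sx: (S x); rewrite ?eqxx //.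
by case Sy: (S y); rewrite ?eqxx // !fh.
Qed.

Lemma computable_congr f h t :
  (forall x y, f x != f y -> h x != h y) -> computable h t -> computable f t.
Proof.
move=> fh /(@solves_scale f _ _ _ (fun=> 1)) fS.
apply: solves_eq (fS _) => [x y|x y _ _]; last exact: fh.
by rewrite /gram /= !big_seq1 /= !mulr1.
Qed.

Lemma computable_ext f h t : f =1 h -> computable h t -> computable f t.
Proof. by move=> fh; apply: computable_congr => x y; rewrite !fh. Qed.

Lemma computable_neg f t : computable f t -> computable (fun x => ~~ f x) t.
Proof. by apply: computable_congr => x y; case: (f x) (f y) => [] []. Qed.

Lemma computable_const b t : computable (fun=> b) t.
Proof.
by apply: (@solves_mono _ 0) => // x y; rewrite eqxx.
Qed.

(** Final states with different values of [g] are orthogonal, so the last list can be split by that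
    value without changing its Gram matrix, and each part continued separately. *)
Lemma solves_comp f g s t L :
    solves g s L ->
    (forall b, solves f t [:: (None, indicator (fun x => g x == b))]) ->
  solves f (s + t) L.
Proof.
move=> gL fg; elim: s L gL => [|s IHs] L /=; last first.
  by case=> L' eqL gL; exists L' => //; apply: IHs.
move=> gL; rewrite add0n.
pose part b := map (scale (indicator (fun x => g x == b))) L.
have fpart b : solves f t (part b).
  rewrite {}/part {gL}; elim: L => [|v L IHL]; first exact: solves_nil.
  rewrite -cat1s map_cat; apply: solves_cat => //=.
  (* Gram matrices ignore labels, so one coordinate of the part counts as the indicator list scaled
     by its amplitude. *)
  have := @solves_scale f f _ _ v.2 (fun x y _ _ => id) (fg b).
  by apply: solves_eq => x y; rewrite /gram !big_seq1 /=; ring.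
apply: solves_eq (solves_cat (fpart true) (fpart false)) => x y.
rewrite gram_cat !gram_scale /indicator.
have [eqg|/gL ->] := eqVneq (g x) (g y); last by rewrite !mulr0 addr0.
by rewrite eqg; case: (g y); rewrite ?mulr1 ?mul1r ?mul0r ?addr0 ?add0r.
Qed.

Lemma computable_comp f g (h : bool -> boolfun n) s t m :
    computable g s -> (forall b, computable (h b) t) ->
    (forall x, f x = h (g x) x) -> (s + t <= m)%N ->
  computable f m.
Proof.
move=> gs ht fE /solves_mono; apply; apply: solves_comp gs _ => b.
by apply: computable_on (ht b) => x /eqP <-.
Qed.

End StateLists.

(** * Query bounds for formulas, and the query saved by mixed connectives *)

Section Formulas.
Variables (R : realType) (n : nat).
Local Notation X := (input n).
Local Notation computable := (@computable R n).

Implicit Types (phi psi A B : formula n) (l : bool * 'I_n).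

Definition leaf l : formula n := Lit l.1 l.2.

Fixpoint leaves phi : nat :=
  match phi with
  | Lit _ _ => 1
  | And A B | Or A B => leaves A + leaves B
  end.

Lemma leaves_gt0 phi : (0 < leaves phi)%N.
Proof. by elim: phi => //= A A_gt0 B _; rewrite addn_gt0 A_gt0. Qed.

Lemma size_leaf_variables phi : size (leaf_variables phi) = leaves phi.
Proof. by elim: phi => //= A <- B <-; rewrite size_cat. Qed.

Fixpoint negf phi : formula n :=
  match phi with
  | Lit s i => Lit (~~ s) i
  | And A B => Or (negf A) (negf B)
  | Or A B => And (negf A) (negf B)
  end.

Lemma eval_negf phi x : eval_formula (negf phi) x = ~~ eval_formula phi x.
Proof.
by elim: phi => [[] i|A IHA B IHB|A IHA B IHB] //=;
  rewrite ?negbK // IHA IHB ?negb_and ?negb_or.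
Qed.

Lemma leaves_negf phi : leaves (negf phi) = leaves phi.
Proof. by elim: phi => //= A -> B ->. Qed.

Lemma leaf_variables_negf phi : leaf_variables (negf phi) = leaf_variables phi.
Proof. by elim: phi => //= A -> B ->. Qed.

Lemma computable_leaf l : computable (eval_formula (leaf l)) 1.
Proof.
case: l => s i.
(* Half of the squared norm is idle and half sits on [i]; two coordinates for each avoid a square
   root of 2. After the query, inputs that differ at [i] have inner product 1/2 - 1/2. *)
exists [:: (None, fun=> 1 / 2); (None, fun=> 1 / 2);
           (Some i, fun=> 1 / 2); (Some i, fun=> 1 / 2)].
  by move=> x y; rewrite /gram !big_cons !big_nil /=; field.
move=> x y /=; rewrite /gram /= !big_cons !big_nil /=.
by case: s (x i) (y i) => [] [] [] //= _; rewrite ?expr1 ?expr0; lra.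
Qed.

Definition sgn_leaf l (x : X) : R := (-1) ^+ eval_formula (leaf l) x.

(** A negated literal flips the sign at both inputs and the two flips cancel, so Gram entries can be
    computed with literals in place of variables. *)
Lemma phase_leaf l (x y : X) (a b : R) :
  ((-1) ^+ x l.2 * a) * ((-1) ^+ y l.2 * b) =
  (sgn_leaf l x * a) * (sgn_leaf l y * b).
Proof.
by rewrite /sgn_leaf; case: l => s i /=; case: s (x i) (y i) => [] [] [];
  rewrite ?expr0 ?expr1; ring.
Qed.

(* The lists below solve the Gram matrix equations of a two-query algorithm;
   they were found numerically and rationalised. *)
Lemma computable_gadget (l1 l2 l3 : bool * 'I_n) :
  computable (eval_formula (And (Or (leaf l1) (leaf l2)) (leaf l3))) 2.
Proof.
pose p := sgn_leaf l1; pose q := sgn_leaf l2.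
exists [:: (None, fun=> 1 / 2); (None, fun=> 1 / 2);
           (Some l1.2, fun=> 1 / 2); (Some l2.2, fun=> 1 / 2)].
  by move=> x y; rewrite /gram !big_cons !big_nil /=; field.
exists [:: (Some l1.2, fun x => (1 - p x) / 4);
           (Some l1.2, fun x => (2 + p x + q x) / 8);
           (Some l1.2, fun x => (2 + p x + q x) / 8);
           (Some l2.2, fun x => (1 - q x) / 4);
           (Some l2.2, fun x => (2 + p x + q x) / 8);
           (Some l2.2, fun x => (2 + p x + q x) / 8);
           (Some l3.2, fun x => (1 - p x) / 4);
           (Some l3.2, fun x => (p x - q x) / 4);
           (Some l3.2, fun x => (1 - q x) / 4)].
  move=> x y; rewrite /gram big_map !big_cons !big_nil /=.
  by rewrite !(phase_leaf l1) !(phase_leaf l2) {}/p {}/q; field.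
move=> x y fxy; rewrite /gram big_map !big_cons !big_nil /=.
rewrite !(phase_leaf l1) !(phase_leaf l2) !(phase_leaf l3) {}/p {}/q /sgn_leaf.
have evalE z : eval_formula (And (Or (leaf l1) (leaf l2)) (leaf l3)) z =
  (eval_formula (leaf l1) z || eval_formula (leaf l2) z)
    && eval_formula (leaf l3) z by [].
move: fxy; rewrite !evalE.
move: (eval_formula (leaf l1) x) (eval_formula (leaf l2) x)
  (eval_formula (leaf l3) x) (eval_formula (leaf l1) y)
  (eval_formula (leaf l2) y) (eval_formula (leaf l3) y).
by move=> [] [] [] [] [] [] //= _; rewrite ?expr1 ?expr0; lra.
Qed.

(** This reduces a bound for any subformula [A] to constants and literals. [A] is read from the
    left; when a part of it decides its value, at least one leaf is still unread, which leaves the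
    [k.+1] queries that [h b] needs. *)
Lemma computable_plug (h : bool -> boolfun n) k A :
    (forall b, computable (h b) k.+1) ->
    (forall l, computable (fun x => h (eval_formula (leaf l) x) x) k.+1) ->
  computable (fun x => h (eval_formula A x) x) (leaves A + k).
Proof.
move=> hb hl.
suff: computable (eval_formula A) (leaves A) /\
  computable (fun x => h (eval_formula A x) x) (leaves A + k) by case.
elim: A => [s i|A [cA _] B [cB IHB]|A [cA _] B [cB IHB]] /=.
- by split; [apply: (computable_leaf (s, i)) | apply: (hl (s, i))].
- split.
    apply: (computable_comp (h := fun b x => b && eval_formula B x)
      (t := leaves B)) cA _ _ _ => //.
    by case=> //=; apply: computable_const.
  apply: (computable_comp (h := fun b x => h (b && eval_formula B x) x)
    (t := (leaves B + k)%N)) cA _ _ _ => //; last by rewrite addnA.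
  by case=> //=; apply: solves_mono (hb _); rewrite -add1n leq_add2r leaves_gt0.
- split.
    apply: (computable_comp (h := fun b x => b || eval_formula B x)
      (t := leaves B)) cA _ _ _ => //.
    by case=> //=; apply: computable_const.
  apply: (computable_comp (h := fun b x => h (b || eval_formula B x) x)
    (t := (leaves B + k)%N)) cA _ _ _ => //; last by rewrite addnA.
  by case=> //=; apply: solves_mono (hb _); rewrite -add1n leq_add2r leaves_gt0.
Qed.

Lemma computable_formula A : computable (eval_formula A) (leaves A).
Proof.
rewrite -[leaves A]addn0.
apply: (@computable_plug (fun b _ => b)) => [b|l].
  exact: computable_const.
exact: computable_leaf.
Qed.

(** Three uses of [computable_plug] replace [A1], [A2] and [B] in turn by literals, down to
    [computable_gadget]. *)
Lemma computable_and_or A1 A2 B :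
  computable (eval_formula (And (Or A1 A2) B))
    (leaves A1 + leaves A2 + leaves B).-1.
Proof.
have cAndB C b : computable (fun x => b && eval_formula C x) (leaves C).
  by case: b; [apply: computable_formula | apply: computable_const].
have step3 l1 l2 : computable
    (eval_formula (And (Or (leaf l1) (leaf l2)) B)) (leaves B + 1).
  apply: (@computable_plug
    (fun b x => eval_formula (Or (leaf l1) (leaf l2)) x && b)) => [b|l3].
    apply: computable_ext (fun x => andbC _ _) _.
    exact: (cAndB (Or (leaf l1) (leaf l2))).
  exact: computable_gadget.
have step2 l1 : computable
    (eval_formula (And (Or (leaf l1) A2) B)) (leaves A2 + leaves B).
  apply: (@computable_plug (fun b x =>
    (eval_formula (leaf l1) x || b) && eval_formula B x)) => [[]|l2].
  - apply: (computable_ext (h := eval_formula B)) => [x|].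
      by rewrite orbT.
    exact: solves_mono (leqnSn _) (computable_formula B).
  - apply: (computable_ext (h := eval_formula (And (leaf l1) B))) => [x|].
      by rewrite orbF.
    exact: computable_formula.
  - by rewrite -addn1; apply: step3.
(* This gives the budget the shape [leaves A1 + k], with [k.+1] equal to [leaves A2 + leaves B]. *)
rewrite -addnA -(ltn_predK (leaves_gt0 A2)) addSn addnS /=.
apply: (@computable_plug (fun b x =>
  (b || eval_formula A2 x) && eval_formula B x)) => [[]|l1].
- by apply: solves_mono (computable_formula B); rewrite -addSn leq_addl.
- by rewrite -addSn (ltn_predK (leaves_gt0 A2)); apply: computable_formula (And A2 B).
- by rewrite -addSn (ltn_predK (leaves_gt0 A2)); apply: step2.
Qed.

Lemma computable_or_and A1 A2 B :
  computable (eval_formula (Or (And A1 A2) B))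
    (leaves A1 + leaves A2 + leaves B).-1.
Proof.
rewrite -(leaves_negf A1) -(leaves_negf A2) -(leaves_negf B).
apply: computable_ext (computable_neg (computable_and_or _ _ _)) => x.
by rewrite -eval_negf /= !eval_negf !negbK.
Qed.

Fixpoint pure_and phi : bool :=
  match phi with
  | Lit _ _ => true
  | And A B => pure_and A && pure_and B
  | Or _ _ => false
  end.

Lemma negfK : involutive negf.
Proof. by elim=> [s i|A IHA B IHB|A IHA B IHB] /=; rewrite ?negbK ?IHA ?IHB. Qed.

(** The second hypothesis says that [phi] is not a disjunction of literals, so the notion is
    self-dual. *)
Definition shortcut phi : Prop :=
  ~~ pure_and phi -> ~~ pure_and (negf phi) ->
  computable (eval_formula phi) (leaves phi).-1.

Lemma shortcut_negf phi : shortcut (negf phi) -> shortcut phi.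
Proof.
rewrite /shortcut negfK leaves_negf => sphi pure_phi pure_nphi.
apply: computable_ext (computable_neg (sphi pure_nphi pure_phi)) => x.
by rewrite eval_negf negbK.
Qed.

(** If [A] is a disjunction, [computable_and_or] saves the query. If it is a conjunction, its
    negation is a disjunction, so [shortcut A] applies and reading [B] afterwards keeps the
    saving. *)
Lemma computable_andl A B : shortcut A -> ~~ pure_and A ->
  computable (eval_formula (And A B)) (leaves A + leaves B).-1.
Proof.
case: A => [//|A1 A2|A1 A2] sA pA; last exact: computable_and_or.
have A_gt0 := leaves_gt0 (And A1 A2).
apply: (computable_comp (h := fun b x => b && eval_formula B x)
  (t := leaves B)) (sA pA isT) _ _ _ => //; last by lia.
by case=> //=; [apply: computable_formula | apply: computable_const].
Qed.

Lemma shortcut_and A B : shortcut A -> shortcut B -> shortcut (And A B).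
Proof.
move=> sA sB /=; rewrite /shortcut /= negb_and => /orP[pA|pB] _.
  exact: computable_andl.
rewrite addnC; apply: computable_ext (computable_andl A sB pB) => x.
exact: andbC.
Qed.

Lemma computable_mixed phi : shortcut phi.
Proof.
elim: phi => [//|A sA B sB|A sA B sB]; first exact: shortcut_and.
apply: shortcut_negf => /=.
by apply: shortcut_and; apply: shortcut_negf; rewrite negfK.
Qed.

(** No variable is shared by the two sides of a conjunction, so their negation vectors can be
    glued. *)
Lemma eval_pure_and phi : uniq (leaf_variables phi) -> pure_and phi ->
  exists a : {ffun 'I_n -> bool}, forall x,
    eval_formula phi x = all (fun i => a i (+) x i) (leaf_variables phi).
Proof.
elim: phi => [s i|A IHA B IHB|//] /=.
  move=> _ _; exists [ffun=> ~~ s] => x /=; rewrite ffunE andbT.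
  by case: s (x i) => [] [].
rewrite cat_uniq => /and3P[uA /hasPn AB uB] /andP[pA pB].
have [a aE] := IHA uA pA; have [b bE] := IHB uB pB.
exists [ffun i => if i \in leaf_variables A then a i else b i] => x.
rewrite all_cat aE bE; congr andb; apply: eq_in_all => i iP; rewrite ffunE.
  by rewrite iP.
by rewrite (negPf (AB i iP)).
Qed.

(** The bit [c] also covers disjunctions, through their negations. *)
Lemma isomorphic_pure_and (f : boolfun n) phi c :
    (forall i, count_mem i (leaf_variables phi) = 1%N) ->
    (forall x, f x = c (+) eval_formula phi x) -> pure_and phi ->
  isomorphic_boolfun f (@ANDn n).
Proof.
move=> count1 fE pphi.
have phi_all i : i \in leaf_variables phi by rewrite -has_pred1 has_count count1.
have uphi : uniq (leaf_variables phi).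
  by apply/count_mem_uniq => i; rewrite phi_all count1.
have [a aE] := eval_pure_and uphi pphi.
exists 1%g, a, c => x; rewrite fE aE /ANDn; congr addb.
apply/allP/forallP => [H i|H i _]; last by have := H i; rewrite ffunE perm1.
by rewrite ffunE perm1 H.
Qed.

End Formulas.

(** * Orthogonal maps between families with equal Gram matrices *)

Section Orthogonal.
Variables (F : realFieldType) (d : nat).
Implicit Types (u v w a b : 'cV[F]_d) (U : 'M[F]_d).

Definition dotc u v : F := (u^T *m v) 0 0.

Lemma dotcE u v : dotc u v = \sum_i u i 0 * v i 0.
Proof. by rewrite /dotc mxE; apply: eq_bigr => i _; rewrite mxE. Qed.

Lemma dotcC u v : dotc u v = dotc v u.
Proof. by rewrite !dotcE; apply: eq_bigr => i _; rewrite mulrC. Qed.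

Lemma dotcBl u v w : dotc (u - v) w = dotc u w - dotc v w.
Proof. by rewrite /dotc linearB mulmxBl !mxE. Qed.

Lemma dotcBr u v w : dotc w (u - v) = dotc w u - dotc w v.
Proof. by rewrite !(dotcC w) dotcBl. Qed.

Lemma dotc_eq0 u : dotc u u = 0 -> u = 0.
Proof.
rewrite dotcE => /eqP; rewrite psumr_eq0 => [/allP u0|i _]; last exact: sqr_ge0.
apply/colP => i; rewrite mxE; apply/eqP.
by have := u0 i (mem_index_enum _); rewrite /= mulf_eq0 orbb.
Qed.

Lemma dotc_orthogonal U u v : U^T *m U = 1%:M -> dotc (U *m u) (U *m v) = dotc u v.
Proof.
by move=> UU; rewrite /dotc trmx_mul -mulmxA (mulmxA U^T) UU mul1mx.
Qed.

(* At w = 0 the coefficient is 2 / 0 = 0, so this is the identity matrix. *)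
Definition householder w : 'M[F]_d := 1%:M - (2 / dotc w w) *: (w *m w^T).

Lemma householder_mul w v :
  householder w *m v = v - (2 / dotc w w * dotc w v) *: w.
Proof.
rewrite mulmxBl mul1mx -scalemxAl -mulmxA [w^T *m v]mx11_scalar.
by rewrite mul_mx_scalar scalerA.
Qed.

Lemma householder_tr w : (householder w)^T = householder w.
Proof. by rewrite linearB linearZ /= trmx1 trmx_mul trmxK. Qed.

Lemma householder_orthogonal w : (householder w)^T *m householder w = 1%:M.
Proof.
rewrite householder_tr {1}/householder mulmxBl mul1mx -scalemxAl.
have [w0|w_neq0] := eqVneq (dotc w w) 0.
  by rewrite /householder w0 invr0 mulr0 !scale0r !subr0.
rewrite -mulmxA -{2}householder_tr -trmx_mul householder_mul divfK //.
have -> : w - 2 *: w = - w by rewrite scaler_nat mulr2n opprD addNKr.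
by rewrite linearN /= mulmxN scalerN opprK /householder subrK.
Qed.

(** For vectors of equal length, [w = a - b] satisfies [dotc w w = 2 * dotc w a], so reflecting [a]
    subtracts exactly [w]. *)
Lemma householder_swap a b :
  dotc a a = dotc b b -> householder (a - b) *m a = b.
Proof.
move=> ab; have [/dotc_eq0 w0|w_neq0] := eqVneq (dotc (a - b) (a - b)) 0.
  rewrite householder_mul w0 scaler0 subr0.
  by apply/eqP; rewrite -subr_eq0 w0.
rewrite householder_mul; suff -> : 2 / dotc (a - b) (a - b) * dotc (a - b) a = 1.
  by rewrite scale1r opprB addrC subrK.
rewrite mulrAC; apply: (canLR (mulfK w_neq0)).
by rewrite !(dotcBl, dotcBr) (dotcC b a) -ab; ring.
Qed.

(** Given [U] for the tail, the reflection taking [U *m a p] to [b p] is applied after it. Equal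
    inner products make every earlier [b q] orthogonal to [U *m a p - b p], hence fixed. *)
Lemma orthogonal_extension (T : eqType) (s : seq T) (a b : T -> 'cV[F]_d) :
    {in s &, forall p q, dotc (a p) (a q) = dotc (b p) (b q)} ->
  exists2 U, U^T *m U = 1%:M & {in s, forall p, U *m a p = b p}.
Proof.
elim: s => [|p s IHs] ab.
  by exists 1%:M => //; rewrite trmx1 mulmx1.
have [q r qs rs|U UU Ua] := IHs; first by apply: ab; rewrite inE (qs, rs) orbT.
pose H := householder (U *m a p - b p).
exists (H *m U).
  by rewrite trmx_mul -mulmxA (mulmxA H^T) householder_orthogonal mul1mx.
move=> q; rewrite inE -mulmxA => /predU1P[->|qs].
  by apply: householder_swap; rewrite dotc_orthogonal // ab ?mem_head.
suff w_orth : dotc (U *m a p - b p) (b q) = 0.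
  by rewrite Ua // householder_mul w_orth mulr0 scale0r subr0.
rewrite dotcBl -{1}(Ua q qs) dotc_orthogonal //.
by rewrite ab ?mem_head ?inE ?qs ?orbT // subrr.
Qed.

End Orthogonal.

(** * From lists of amplitudes to genuine query algorithms *)

Section Realization.
Variables (R : realType) (n : nat).
Local Notation X := (input n).
Local Notation labelled := (labelled R n).
Local Notation C := (real_complex R).
Implicit Types (f : boolfun n) (L : seq labelled).

Lemma real_unitarymx d (U : 'M[R]_d) :
  U^T *m U = 1%:M -> map_mx C U \is unitarymx.
Proof.
move=> UU; apply/unitarymxP.
have -> : (map_mx C U ^t*)%sesqui = map_mx C U^T.
  by apply/matrixP => i j; rewrite !mxE; apply: conjc_real.
by rewrite -map_mxM (mulmx1C UU) map_mx1.
Qed.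

Lemma normr_real_complex (z : R) : `|C z| ^+ 2 = C (z * z).
Proof.
by rewrite real_normK ?rmorphM -?expr2 //; apply/complex_realP; exists z.
Qed.

Definition null : labelled := (None, fun=> 0).

Lemma solves_run f t L : solves f t L ->
  exists S : nat -> seq labelled,
    [/\ gram (S 0) =2 gram L,
        forall k, (k < t)%N -> gram (S k.+1) =2 gram (map (@query R n) (S k)) &
        forall i x y, f x != f y ->
          (nth null (S t) i).2 x * (nth null (S t) i).2 y = 0].
Proof.
elim: t L => [|t IHt] L /= => [fL|[L' eqL /IHt[S [S0 SS St]]]]; last first.
  by exists (fun k => if k is k'.+1 then S k' else L'); split=> // -[|k] //= /SS.
(* Splitting the last list by the value of [f] keeps its Gram matrix and makes each coordinate
   vanish on all inputs of one answer, as a measurement in the standard basis requires. *)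
pose part b := map (scale (fun x => (f x == b)%:R)) L.
exists (fun=> part true ++ part false); split=> // [x y|i x y].
  rewrite gram_cat !gram_scale.
  have [->|/fL ->] := eqVneq (f x) (f y); last by rewrite !mulr0 addr0.
  by case: (f y); rewrite ?mulr1 ?mul1r ?mul0r ?addr0 ?add0r.
have part0 b j : f x != f y ->
    (nth null (part b) j).2 x * (nth null (part b) j).2 y = 0.
  move=> fxy; have [jL|Lj] := ltnP j (size L); last first.
    by rewrite nth_default ?size_map //= mul0r.
  rewrite (nth_map null) //= mulrACA -natrM mulnb.
  by case: b (f x) (f y) fxy => [] [] [] //= _; rewrite mul0r.
by move=> fxy; rewrite nth_cat; case: ifP => _; apply: part0.
Qed.

Lemma gram_query_diag L x : gram (map (@query R n) L) x x = gram L x x.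
Proof.
rewrite /gram big_map; apply: eq_bigr => v _ /=; rewrite mulrACA.
suff -> : phase R v.1 x * phase R v.1 x = 1 by rewrite mul1r.
by case: v.1 => [i|] /=; rewrite ?mulr1 // -expr2 sqrr_sign.
Qed.

(* The state space is the direct sum of the supports of the successive states,
   so that the labels of a basis state do not depend on time. *)
Section DirectSum.
Variables (S : nat -> seq labelled) (t : nat).

Definition basis : seq (nat * labelled) :=
  flatten [seq [seq (k, v) | v <- S k] | k <- iota 0 t.+1].

Local Notation d := (size basis).
Local Notation "b .-vec" := (nth (0%N, null) basis b) (at level 2, format "b .-vec").

Lemma nth_basis (b : 'I_d) : exists i, b.-vec.2 = nth null (S b.-vec.1) i.
Proof.
case: b => b /=; rewrite /basis; elim: (iota 0 t.+1) b => [|k ks IHks] b //=.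
rewrite size_cat size_map nth_cat size_map => b_lt.
have [b_k|k_b] := ltnP b (size (S k)); last by apply: IHks; rewrite ltn_subLR.
by exists b; rewrite (nth_map null).
Qed.

(** Taking [q] to be [id] or [query] gives the state before or after the query, in the same block of
    coordinates. *)
Definition state (q : labelled -> labelled) (k : nat) (x : X) : 'cV[R]_d :=
  \col_b (if b.-vec.1 == k then (q b.-vec.2).2 x else 0).

Lemma dotc_state q k x y : (k <= t)%N ->
  dotc (state q k x) (state q k y) = gram (map q (S k)) x y.
Proof.
move=> kt; rewrite dotcE.
under eq_bigr do rewrite !mxE.
rewrite -(big_mkord xpredT (fun b =>
  (if b.-vec.1 == k then (q b.-vec.2).2 x else 0) *
  (if b.-vec.1 == k then (q b.-vec.2).2 y else 0))).
rewrite -(big_nth _ xpredT (fun e : nat * labelled =>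
  (if e.1 == k then (q e.2).2 x else 0) *
  (if e.1 == k then (q e.2).2 y else 0))).
rewrite big_flatten big_map (bigD1_seq k) ?iota_uniq ?mem_iota //=.
rewrite big_map /= eqxx [X in _ + X]big1 => [|j jk]; last first.
  by rewrite big_map big1 // => v _ /=; rewrite (negPf jk) mul0r.
by rewrite addr0 /gram big_map.
Qed.

Definition label (b : 'I_d) : option 'I_n := b.-vec.2.1.

Lemma query_state k x :
  query_mx R label x *m map_mx C (state id k x) =
  map_mx C (state (@query R n) k x).
Proof.
apply/colP => b; rewrite mul_diag_mx !mxE /label.
case: eqP => _; last by rewrite rmorph0 mulr0.
rewrite /= /phase rmorphM; case: (b.-vec.2.1) => [i|] /=; last by rewrite rmorph1.
by rewrite rmorphXn rmorphN1.
Qed.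

End DirectSum.

Lemma exactly_computable_computable f t :
  computable R f t -> exactly_computable R f t.
Proof.
case/solves_run=> S [S0 SS St].
pose d := size (basis S t).
pose psi q k x : 'cV[R]_d := state S t q k x.
pose x0 : X := [ffun=> false].
have S0_1 x y : gram (S 0) x y = 1 by rewrite S0 /gram big_seq1 mulr1.
have norm_state k x : (k <= t)%N -> dotc (psi id k x) (psi id k x) = 1.
  move=> kt; rewrite dotc_state // map_id.
  by elim: k kt => [|k IHk] kt; rewrite ?S0_1 // SS // gram_query_diag IHk // ltnW.
(* The vector that the unitary of index [k] must send to [psi id k x]. At time 0 all inner products
   are 1, so [psi id 0 x] does not depend on [x] and the choice of [x0] is immaterial. *)
pose before k x := if k is k'.+1 then psi (@query R n) k' x else psi id 0%N x0.
have /choice[U UP] : forall k, exists U : 'M[R]_d, U^T *m U = 1%:M /\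
    ((k <= t)%N -> forall x, U *m before k x = psi id k x).
  move=> k; have [kt|_] := leqP k t; last first.
    by exists 1%:M; rewrite trmx1 mulmx1.
  have [|V VV Vx] := @orthogonal_extension R d {ffun 'I_n -> bool}
      (enum {ffun 'I_n -> bool}) (before k) (psi id k).
    move=> x y _ _; rewrite [RHS]dotc_state // map_id.
    by case: k kt => [|k] kt; rewrite dotc_state ?map_id ?S0_1 ?SS // ltnW.
  by exists V; split=> // _ x; apply: Vx; rewrite mem_enum.
have init_unit : \sum_b `|map_mx C (psi id 0%N x0) b 0| ^+ 2 = 1.
  under eq_bigr do rewrite mxE normr_real_complex.
  by rewrite -rmorph_sum -dotcE norm_state.
have unitaryP j : (j <= t)%N -> map_mx C (U j) \is unitarymx.
  by move=> _; apply: real_unitarymx; case: (UP j).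
(* By [St], a coordinate that is nonzero at the last time for some input with answer true is zero
   for all inputs with answer false. *)
pose out (b : 'I_d) : bool :=
  [exists x : {ffun 'I_n -> bool}, f x && (psi id t x b 0 != 0)].
pose A := QueryAlgorithm (@label S t) out init_unit unitaryP.
have A_state k x : (k <= t)%N -> qa_state A x k = map_mx C (psi id k x).
  elim: k => [|k IHk] kt /=.
    by rewrite -map_mxM; congr map_mx; have [_] := UP 0%N; apply.
  rewrite (IHk (ltnW kt)) [query_mx _ _ _ *m _](query_state S t k x) -map_mxM.
  by congr map_mx; apply: (proj2 (UP k.+1) kt x).
exists A => x; rewrite /output_probability A_state //.
rewrite -[RHS](rmorph1 C) -(norm_state t x) // dotcE rmorph_sum.
rewrite [RHS](bigID (fun b => out b == f x)) /=.
rewrite [X in _ = _ + X]big1 ?addr0 => [|b].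
  by apply: eq_bigr => b _; rewrite mxE normr_real_complex.
apply: contraNeq => xb; have {}xb : psi id t x b 0 != 0.
  by apply: contraNneq xb => ->; rewrite mul0r rmorph0.
case fx: (f x); first by apply/eqP/existsP; exists x; rewrite fx.
rewrite eqbF_neg; apply/existsP => -[y /andP[fy]].
have [i bE] := nth_basis b; have := St i x y; rewrite fx fy => /(_ isT).
move: xb; rewrite !mxE bE; case: ifP => [/eqP-> /= x_neq0 /eqP|]; last by rewrite eqxx.
by rewrite mulf_eq0 (negPf x_neq0) => /= ->.
Qed.

End Realization.

(** * The lower bound by the polynomial method *)

Section LowerBound.
Variables (R : realType) (n : nat).
Local Notation X := {ffun 'I_n -> bool}.
Local Notation C := R[i].
Implicit Types (T : {set 'I_n}) (x : X) (f : boolfun n).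

Definition chi T x : C := \prod_(i in T) (-1) ^+ x i.

(** [T'] is the symmetric difference of [T] and the singleton of [i], because signs square to 1. *)
Lemma chi_toggle T i : exists2 T' : {set 'I_n},
  (#|T| <= #|T'|.+1)%N & forall x, chi T x * (-1) ^+ x i = chi T' x.
Proof.
have [iT|iT] := boolP (i \in T).
  exists (T :\ i) => [|x]; first by rewrite [leqLHS](cardsD1 i) iT.
  by rewrite /chi (big_setD1 i) //= mulrAC -expr2 sqrr_sign mul1r.
exists (i |: T) => [|x]; first by rewrite cardsU1 iT /= add1n; lia.
by rewrite /chi big_setU1 //= mulrC.
Qed.

Lemma sum_chi T : (0 < #|T|)%N -> \sum_x chi T x = 0.
Proof.
case/card_gt0P=> i iT; under eq_bigr => x _ do rewrite /chi big_mkcond /=.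
rewrite -(bigA_distr_bigA (fun j (b : bool) => if j \in T then (-1) ^+ b else 1)).
by rewrite (bigD1 i) //= iT big_bool /= expr1 expr0 ?addNr ?subrr mul0r.
Qed.

Lemma norm_unitary d (U : 'M[C]_d) (v : 'cV_d) : U \is unitarymx ->
  \sum_b `|(U *m v) b 0| ^+ 2 = \sum_b `|v b 0| ^+ 2.
Proof.
move=> /unitarymxP/mulmx1C UU.
have normE (w : 'cV[C]_d) : \sum_b `|w b 0| ^+ 2 = (map_mx Num.conj w^T *m w) 0 0.
  by rewrite mxE; apply: eq_bigr => b _; rewrite !mxE normCK mulrC.
by rewrite !normE trmx_mul map_mxM -mulmxA (mulmxA _ U) UU mul1mx.
Qed.

Section Algorithm.
Variables (t : nat) (A : query_algorithm R n t).

Lemma norm_state x k : (k <= t)%N -> \sum_b `|qa_state A x k b 0| ^+ 2 = 1.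
Proof.
elim: k => [|k IHk] kt /=; rewrite norm_unitary ?qa_unitaryP //.
  exact: qa_init_unit.
rewrite -(IHk (ltnW kt)); apply: eq_bigr => b _.
rewrite mul_diag_mx !mxE normrM; case: (qa_label A b) => [i|].
  by rewrite normrX normrN1 expr1n mul1r.
by rewrite normr1 mul1r.
Qed.

(* Each query raises the degree of the amplitudes by at most one. *)
Lemma fourier_state k b T :
  (k < #|T|)%N -> \sum_x chi T x * qa_state A x k b 0 = 0.
Proof.
elim: k b T => [|k IHk] b T kT /=.
  by rewrite -mulr_suml sum_chi ?mul0r.
under eq_bigr => x _ do rewrite mxE mulr_sumr.
rewrite exchange_big big1 //= => j _.
under eq_bigr => x _ do rewrite mul_diag_mx !mxE mulrCA.
rewrite -mulr_sumr; apply/eqP; rewrite mulf_eq0; apply/orP; right; apply/eqP.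
under eq_bigr => x _ do rewrite mulrA.
case: (qa_label A j) => [i|]; last first.
  by under eq_bigr do rewrite mulr1; apply/IHk/ltnW.
have [T' TT' chiE] := chi_toggle T i.
under eq_bigr do rewrite chiE.
by apply: IHk; rewrite -ltnS (leq_trans kT).
Qed.

(** Exactness kills the amplitudes for the answer [f x0] at every other input. If [t < n], their top
    Fourier coefficient is zero too; it reduces to the term at [x0], so they vanish there as well,
    against probability 1. *)
Lemma exact_lower_bound f x0 :
  (forall x, x != x0 -> f x = ~~ f x0) -> computes_exactly A f -> (n <= t)%N.
Proof.
move=> f_x0 A_f; rewrite leqNgt; apply/negP => tn.
have amp0 b x : qa_output A b == f x0 -> x != x0 -> qa_state A x t b 0 = 0.
  move=> out_b xx0; have := norm_state x (leqnn t).
  rewrite (bigID (fun b => qa_output A b == f x)) /= -/(output_probability A x (f x)).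
  rewrite A_f => /(canRL (addKr _)); rewrite addNr => /eqP.
  rewrite psumr_eq0 => [/allP/(_ b (mem_index_enum _))|j _]; last exact: exprn_ge0.
  have -> : qa_output A b != f x by rewrite f_x0 // (eqP out_b); case: (f x0).
  by rewrite /= expf_eq0 normr_eq0 => /eqP.
have := A_f x0; rewrite /output_probability big1 => [/esym/eqP|b out_b].
  by rewrite oner_eq0.
have := @fourier_state t b [set: 'I_n]; rewrite cardsT card_ord => /(_ tn).
rewrite (bigD1 x0) //= big1 => [|x xx0]; last by rewrite amp0 ?mulr0.
rewrite addr0 => /eqP; rewrite mulf_eq0 => /orP[|/eqP->]; last first.
  by rewrite normr0 expr0n.
by rewrite /chi => /prodf_eq0[i _]; rewrite signr_eq0.
Qed.

End Algorithm.
End LowerBound.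

(** * Functions isomorphic to AND, and the equivalence *)

Lemma isomorphic_AND_point n (f : boolfun n) : isomorphic_boolfun f (@ANDn n) ->
  exists x0 : {ffun 'I_n -> bool}, forall x, x != x0 -> f x = ~~ f x0.
Proof.
(* The point solves [a i (+) x0 (s i) = true] for all [i]. *)
case=> s [a [c fE]]; exists [ffun i => ~~ a (s^-1 i)%g] => x xx0.
rewrite !fE /ANDn.
have -> : [forall i, [ffun i => a i (+) x (s i)] i] = false.
  apply: contraNF xx0 => /forallP x_all; apply/eqP/ffunP => i; rewrite ffunE.
  by have := x_all (s^-1 i)%g; rewrite ffunE permKV; case: (a _) (x i) => [] [].
have -> : [forall i, [ffun i => a i (+)
    [ffun i => ~~ a (s^-1 i)%g] (s i)] i] = true.
  by apply/forallP => i; rewrite !ffunE permK addbN addbb.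
by rewrite addbF addbT negbK.
Qed.

Theorem theorem4 (R : realType) (n : nat) (f : boolfun n) :
  read_once f -> (is_QE R f n <-> isomorphic_boolfun f (@ANDn n)).
Proof.
case=> phi [count1 fE].
have leaves_n : leaves phi = n.
  rewrite -size_leaf_variables -[RHS]size_enum_ord; apply/perm_size/allP => i _ /=.
  by rewrite count1 count_uniq_mem ?enum_uniq // mem_enum.
split=> [[_ f_min]|f_iso].
- have [pphi|npphi] := boolP (pure_and phi).
    exact: (isomorphic_pure_and (c := false) count1 fE pphi).
  have [pnphi|npnphi] := boolP (pure_and (negf phi)).
    apply: (isomorphic_pure_and (c := true)) pnphi => [i|x].
      by rewrite leaf_variables_negf.
    by rewrite eval_negf /= negbK fE.
  have /f_min : exactly_computable R f n.-1.
    apply/exactly_computable_computable/(computable_ext fE).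
    by have := computable_mixed R npphi npnphi; rewrite leaves_n.
  (* [n <= n.-1] is absurd because a formula has a leaf, so [n] is positive. *)
  by have := leaves_gt0 phi; rewrite leaves_n; lia.
- split.
    apply/exactly_computable_computable/(computable_ext fE).
    by have := computable_formula R phi; rewrite leaves_n.
  have [x0 f_x0] := isomorphic_AND_point f_iso.
  by move=> t [A A_f]; apply: exact_lower_bound f_x0 A_f.
Qed.
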